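(* Let $\mathcal G$ be a fixed, connected, undirected graph on $N\ge 2$ nodes with Laplacian $L$ (largest eigenvalue $\lambda_N(L)$), let $0<\alpha<1/\lambda_N(L)$, $W=I_N-\alpha L$, $\mathbf A_{\mathrm{sys}}=W\otimes I_d-\mathbf P$ and $\sigma:=\|\mathbf A_{\mathrm{sys}}\|_2\in[0,1)$, where $\mathbf P$ is the selector projector defined in the context. Let $(u^k)_{k\ge0}$ be a sequence in $\mathbb R^d$, put $\Delta u^k:=u^{k+1}-u^k$, and let the estimates $\mathbf s^{k,t}$ be generated by the warm-started selector-anchored diffusion recursion of the context with $T$ inner rounds per outer iteration, with errors $\mathbf e^{k,t}=\mathbf s^{k,t}-\mathbf 1_N\otimes u^k$. Then, for every integer $T\ge1$ and every $k\ge0$, $$\|\mathbf e^{k,T}\|_2\le\sigma^T\|\mathbf e^{k,0}\|_2,$$ and moreover $$\|\mathbf e^{k+1,0}\|_2\le\sigma^T\|\mathbf e^{k,0}\|_2+\sqrt N\,\|\Delta u^k\|_2 .$$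
   Context: Graphs are simple and unweighted; $L$ is the combinatorial graph Laplacian. $\|\cdot\|_2$ is the Euclidean/spectral norm, $\otimes$ the Kronecker product, $\mathbf 1_N$ the all-ones vector. Selector matrices: $d=\sum_{i=1}^N d_i$, vectors $u\in\mathbb R^d$ are partitioned into blocks $u_i\in\mathbb R^{d_i}$, and $\mathbf E_i\in\{0,1\}^{d\times d_i}$ is the block-column of $I_d$ corresponding to block $i$; $\mathbf P_i=\mathbf E_i\mathbf E_i^\top$, $\mathbf P=\mathrm{blkdiag}(\mathbf P_1,\dots,\mathbf P_N)$, so $\sum_i\mathbf P_i=I_d$. Recursion (D+LI): given $\mathbf s^{0,0}\in\mathbb R^{Nd}$, for each outer index $k\ge 0$ and inner index $t=0,\dots,T-1$, $$\mathbf s^{k,t+1}=(W\otimes I_d)\mathbf s^{k,t}+\mathbf P\big((\mathbf 1_N\otimes u^k)-\mathbf s^{k,t}\big),$$ with warm start $\mathbf s^{k+1,0}:=\mathbf s^{k,T}$. *)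

(* Defs.v *)
From mathcomp Require Import all_boot all_order all_algebra.
From mathcomp Require Import classical_sets reals.
From mathcomp Require Export mxtens.

Set Implicit Arguments.
Unset Strict Implicit.
Unset Printing Implicit Defensive.

Import Order.TTheory GRing.Theory Num.Theory.
Local Open Scope ring_scope.

Section Norms.
Variable R : realType.

Definition norm2 (n : nat) (x : 'cV[R]_n) : R :=
  Num.sqrt (\sum_(i < n) x i 0 ^+ 2).

(* The unit ball, rather than the unit sphere, is used so that the set is
   nonempty even when n = 0 (the norm is then 0). *)
Definition spectral_norm (m n : nat) (A : 'M[R]_(m, n)) : R :=
  sup [set norm2 (A *m x) | x in [set x : 'cV[R]_n | norm2 x <= 1]]%classic.

(* For a symmetric matrix of positive size the set of eigenvalues is finite and
   nonempty, so that this supremum is a maximum. *)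
Definition largest_eigenvalue (n : nat) (A : 'M[R]_n) : R :=
  sup [set a : R | eigenvalue A a]%classic.

End Norms.

Section Graph.
Variables (R : realType) (N : nat) (e : rel 'I_N).

Definition connected_graph : Prop := forall i j : 'I_N, connect e i j.

Definition degree (i : 'I_N) : nat := #|[set j | e i j]|.

Definition adjacency_mx : 'M[R]_N := \matrix_(i, j) (e i j)%:R.

Definition degree_mx : 'M[R]_N := diag_mx (\row_i (degree i)%:R).

Definition laplacian : 'M[R]_N := degree_mx - adjacency_mx.

End Graph.

Section Selectors.
Variables (R : realType) (N : nat) (dim : 'I_N -> nat).

Local Notation d := (\sum_(i < N) dim i)%N.

Definition block_selector (i : 'I_N) : 'M[R]_(d, dim i) :=
  submxrow (1%:M : 'M[R]_d) i.

Definition block_projector (i : 'I_N) : 'M[R]_d :=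
  block_selector i *m (block_selector i)^T.

Lemma sum_dim_const (n p : nat) : (\sum_(i < n) p)%N = (n * p)%N.
Proof. by rewrite sum_nat_const card_ord. Qed.

(* [\mxdiag] has size [\sum_(i < N) d], whereas [_ *t _] has size [N * d]; the
   cast keeps the position of every entry, and both use the numbering that puts
   entry k of block i at i * d + k. *)
Definition selector_projector : 'M[R]_(N * d) :=
  castmx (sum_dim_const N d, sum_dim_const N d)
    (\mxdiag_(i < N) block_projector i).

End Selectors.

Section Diffusion.
Variable R : realType.

Definition stack (N d : nat) (u : 'cV[R]_d) : 'cV[R]_(N * d) :=
  (const_mx 1 : 'cV[R]_N) *t u.

Definition sys_mx (N : nat) (dim : 'I_N -> nat) (W : 'M[R]_N) :
    'M[R]_(N * \sum_(i < N) dim i) :=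
  W *t 1%:M - selector_projector R dim.

(* [s k t] is the estimate at outer index k and inner round t; only the values
   with t <= T are constrained, and s 0 0 is arbitrary. *)
Definition warm_started_diffusion (N : nat) (dim : 'I_N -> nat) (W : 'M[R]_N)
    (T : nat) (u : nat -> 'cV[R]_(\sum_(i < N) dim i))
    (s : nat -> nat -> 'cV[R]_(N * \sum_(i < N) dim i)) : Prop :=
  (forall k t, (t < T)%N ->
     s k t.+1 = (W *t 1%:M) *m s k t
                + selector_projector R dim *m (stack N (u k) - s k t))
  /\ (forall k, s k.+1 0%N = s k T).

Definition tracking_error (N d : nat) (u : nat -> 'cV[R]_d)
    (s : nat -> nat -> 'cV[R]_(N * d)) (k t : nat) : 'cV[R]_(N * d) :=
  s k t - stack N (u k).

End Diffusion.

(* Main.v *)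
(** The error satisfies [e^{k,t+1} = A_sys e^{k,t}], because [W] fixes the
    all-ones vector; hence everything but [sigma < 1] is the operator norm
    inequality and the triangle inequality.

    [A_sys] is symmetric, so [sigma < 1] follows once every eigenvalue [a] of
    [A_sys] satisfies [|a| < 1]. For a unit eigenvector [x],
    [a = 1 - alpha * Q x - x^T P x], where [Q] is the Dirichlet form of the
    graph summed over the coordinates. As [Q <= lambda_N] and
    [alpha * lambda_N < 1], one gets [a > - x^T P x >= -1]. If [a >= 1], then
    [Q x] and [x^T P x] vanish: each coordinate is constant over the (connected)
    graph and is zero at the node that anchors it, so [x = 0]. *)

Require Import Defs.
From mathcomp Require Import all_boot all_order all_algebra ring lra complex.
From mathcomp Require Import classical_sets reals.

Set Implicit Arguments.
Unset Strict Implicit.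
Unset Printing Implicit Defensive.

Import Order.TTheory GRing.Theory Num.Theory.
Local Open Scope ring_scope.

(** * Inner product and Euclidean norm on real column vectors *)

Section EuclideanNorm.
Variables (R : realType) (n : nat).
Implicit Types (x y : 'cV[R]_n) (a : R).

Definition dot x y : R := \sum_i x i 0 * y i 0.

Lemma dotC x y : dot x y = dot y x.
Proof. by apply: eq_bigr => i _; rewrite mulrC. Qed.

Lemma dotDr x y z : dot x (y + z) = dot x y + dot x z.
Proof. by rewrite -big_split; apply: eq_bigr => i _; rewrite mxE mulrDr. Qed.

Lemma dotZr x a y : dot x (a *: y) = a * dot x y.
Proof.
by rewrite /dot mulr_sumr; apply: eq_bigr => i _; rewrite mxE mulrCA.
Qed.

Lemma dotBr x y z : dot x (y - z) = dot x y - dot x z.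
Proof. by rewrite -scaleN1r dotDr dotZr mulN1r. Qed.

Lemma dotDl x y z : dot (x + y) z = dot x z + dot y z.
Proof. by rewrite dotC dotDr !(dotC z). Qed.

Lemma dotZl a x y : dot (a *: x) y = a * dot x y.
Proof. by rewrite dotC dotZr dotC. Qed.

Lemma dotBl x y z : dot (x - y) z = dot x z - dot y z.
Proof. by rewrite dotC dotBr !(dotC z). Qed.

Lemma dot_ge0 x : 0 <= dot x x.
Proof. by apply: sumr_ge0 => i _; rewrite -expr2 sqr_ge0. Qed.

Lemma dot_eq0 x : dot x x = 0 -> x = 0.
Proof.
move=> /eqP; rewrite psumr_eq0 => [/allP x0|i _]; last first.
  by rewrite -expr2 sqr_ge0.
apply/matrixP => i j; rewrite ord1 !mxE.
by have := x0 i (mem_index_enum _); rewrite mulf_eq0 orbb => /eqP.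
Qed.

Lemma dot_gt0 x : x != 0 -> 0 < dot x x.
Proof.
by move=> x0; rewrite lt_def dot_ge0 andbT; apply: contra_neq x0; apply: dot_eq0.
Qed.

Lemma norm2E x : norm2 x = Num.sqrt (dot x x).
Proof. by congr Num.sqrt; apply: eq_bigr => i _; rewrite expr2. Qed.

Lemma norm2_ge0 x : 0 <= norm2 x. Proof. exact: sqrtr_ge0. Qed.

Lemma sqr_norm2 x : norm2 x ^+ 2 = dot x x.
Proof. by rewrite norm2E sqr_sqrtr ?dot_ge0. Qed.

Lemma norm2_eq0 x : norm2 x = 0 -> x = 0.
Proof. by move=> x0; apply: dot_eq0; rewrite -sqr_norm2 x0 expr0n. Qed.

Lemma norm20 : norm2 (0 : 'cV[R]_n) = 0.
Proof.
rewrite norm2E (_ : dot 0 0 = 0) ?sqrtr0 //.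
by apply: big1 => i _; rewrite mxE mul0r.
Qed.

Lemma norm2Z a x : 0 <= a -> norm2 (a *: x) = a * norm2 x.
Proof.
move=> a0; rewrite !norm2E dotZr dotZl mulrA -expr2.
by rewrite sqrtrM ?sqr_ge0 // sqrtr_sqr ger0_norm.
Qed.

Lemma norm2N x : norm2 (- x) = norm2 x.
Proof. by congr Num.sqrt; apply: eq_bigr => i _; rewrite mxE sqrrN. Qed.

(** Cauchy-Schwarz. For nonzero vectors, the squared norm of [norm2 y *: x - norm2 x *: y] equals
    [2 * norm2 x * norm2 y] times the gap between the two sides, and it is nonnegative. *)
Lemma dot_le_norm2 x y : dot x y <= norm2 x * norm2 y.
Proof.
have [/norm2_eq0 -> | x0] := eqVneq (norm2 x) 0.
  by rewrite norm20 mul0r /dot big1 // => i _; rewrite mxE mul0r.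
have [/norm2_eq0 -> | y0] := eqVneq (norm2 y) 0.
  by rewrite norm20 mulr0 dotC /dot big1 // => i _; rewrite mxE mul0r.
have xy0 : 0 < norm2 x * norm2 y by rewrite mulr_gt0 // lt_def ?x0 ?y0 norm2_ge0.
have := dot_ge0 (norm2 y *: x - norm2 x *: y).
rewrite dotBr !dotBl !dotZl !dotZr [dot y x]dotC -!sqr_norm2 => h; rewrite -(ler_pM2l xy0); lra.
Qed.

Lemma norm2D x y : norm2 (x + y) <= norm2 x + norm2 y.
Proof.
rewrite -(@ler_pXn2r _ 2) ?nnegrE ?addr_ge0 ?norm2_ge0 //.
rewrite sqr_norm2 dotDr !dotDl [dot y x]dotC sqrrD !sqr_norm2.
have := dot_le_norm2 x y; lra.
Qed.

End EuclideanNorm.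

Lemma norm2_le (R : realType) m n (x : 'cV[R]_n) (y : 'cV[R]_m) (M : R) :
  0 <= M -> dot y y <= M ^+ 2 * dot x x -> norm2 y <= M * norm2 x.
Proof.
move=> M0 le_yx.
by rewrite -(@ler_pXn2r _ 2) ?nnegrE ?mulr_ge0 ?norm2_ge0 // exprMn !sqr_norm2.
Qed.

(** * Real spectral theorem, by diagonalizing the complexified matrix *)

Section SymmetricSpectrum.
Variables (R : realType) (n : nat) (A : 'M[R]_n).
Hypothesis A_sym : A^T = A.
Local Notation f := (real_complex R).
Local Open Scope sesquilinear_scope.

Lemma real_complex_real (a : R) : f a \is Num.real.
Proof. by apply/complex_realP; exists a. Qed.

Lemma map_dot (x y : 'cV[R]_n) :
  f (dot x y) = ((map_mx f x) ^t* *m map_mx f y) 0 0.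
Proof.
rewrite rmorph_sum mxE; apply: eq_bigr => i _; rewrite rmorphM !mxE.
by rewrite conj_Creal // real_complex_real.
Qed.

(* [w i] is the squared modulus of the [i]-th coordinate of [x] in a unitary
   eigenbasis of the complexification of [A]. *)
Lemma symmetric_spectral_weights :
  exists l : 'I_n -> R, (forall i, eigenvalue A (l i)) /\
  forall x : 'cV[R]_n, exists2 w : 'I_n -> R, (forall i, 0 <= w i) &
    [/\ dot x x = \sum_i w i, dot x (A *m x) = \sum_i l i * w i
      & dot (A *m x) (A *m x) = \sum_i l i ^+ 2 * w i].
Proof.
pose B := map_mx f A; pose U := spectralmx B; pose D := spectral_diag B.

have B_herm : B \is hermsymmx.
  apply: realsym_hermsym; last by apply/mxOverP => i j; rewrite mxE real_complex_real.
  by apply/is_hermitianmxP; rewrite expr0 scale1r map_mx_id // map_trmx A_sym.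
have BE : B = invmx U *m diag_mx D *m U.
  exact/orthomx_spectralP/hermitian_normalmx.
have Uunit : U \in unitmx by apply: spectral_unit.
have U_unitary : U \is unitarymx by apply: spectral_unitarymx.
have D_real i : f (complex.Re (D 0 i)) = D 0 i.
  apply: RRe_real; exact: (mxOverP (hermitian_spectral_diag_real B_herm)).
have UB : U *m B = diag_mx D *m U by rewrite {1}BE -mulmxA mulKVmx.
(* A unitary change of basis preserves the inner product, so all three identities can be read off in
   eigencoordinates. *)
have dotU (x y : 'cV[R]_n) :
    f (dot x y) = ((U *m map_mx f x) ^t* *m (U *m map_mx f y)) 0 0.
  by rewrite map_dot trmx_mul map_mxM -invmx_unitary // -mulmxA mulKmx.
exists (fun i => complex.Re (D 0 i)); split => [i|x].
  (* Having a real number as eigenvalue is insensitive to the extension of scalars. The eigenvector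
     is row [i] of [U], nonzero because [U] is invertible. *)
  suff: eigenvalue B (f (complex.Re (D 0 i))) by rewrite eigenvalue_map.
  rewrite D_real; apply/eigenvalueP.
  exists (row i U).
    rewrite -row_mul UB; apply/rowP => j.
    by rewrite mxE mul_diag_mx !mxE.
  apply/eqP => /(congr1 (fun v => v *m invmx U)).
  rewrite -row_mul mulmxV // mul0mx => /rowP/(_ i).
  by rewrite !mxE eqxx => /eqP; rewrite oner_eq0.
pose y := U *m map_mx f x.
have yA : U *m map_mx f (A *m x) = diag_mx D *m y.
  by rewrite map_mxM mulmxA UB mulmxA.
pose w i := complex.Re (`|y i 0| ^+ 2).
have fw i : f (w i) = `|y i 0| ^+ 2.
  by apply: RRe_real; rewrite realX // normr_real.
exists w => [i|].
  by rewrite -lecR fw exprn_ge0.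
have fM : {morph f : a b / a * b} by exact: rmorphM.
have f_sum F : f (\sum_i F i) = \sum_(i < n) f (F i) by exact: rmorph_sum.
split; apply: complexI; rewrite dotU ?yA f_sum mxE; apply: eq_bigr => i _.
- by rewrite fw -/y !mxE normCKC.
- by rewrite fM D_real fw -/y mul_diag_mx !mxE normCKC mulrCA.
rewrite expr2 !fM D_real fw mul_diag_mx !mxE normCKC rmorphM /=.
have -> : (D 0 i)^* = D 0 i by rewrite -D_real conj_Creal // real_complex_real.
by ring.
Qed.

End SymmetricSpectrum.

(** * Consequences of the spectral weights for symmetric matrices *)

Section SymmetricSpectrumBounds.
Variables (R : realType) (n : nat) (A : 'M[R]_n).
Hypothesis A_sym : A^T = A.

(** [eigenvalue] speaks of row vectors; symmetry allows transposing to columns. *)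
Lemma symmetric_eigenvector a :
  eigenvalue A a -> exists2 v : 'cV[R]_n, A *m v = a *: v & v != 0.
Proof.
move=> /eigenvalueP[v vA v0]; exists v^T; last by rewrite trmx_eq0.
by rewrite -{1}A_sym -trmx_mul vA linearZ.
Qed.

(** Testing on an eigenvector shows that [a] is a weighted mean of the [l i]. This boundedness makes
    the supremum in [largest_eigenvalue] an upper bound. *)
Lemma has_ubound_eigenvalue : has_ubound [set a | eigenvalue A a]%classic.
Proof.
have [l [_ l_w]] := symmetric_spectral_weights A_sym.
exists (\sum_i `|l i|) => a /= /symmetric_eigenvector[v Av v0].
have [w w_ge0 [vv vAv _]] := l_w v.
rewrite -(ler_pM2r (dot_gt0 v0)) -dotZr -Av vAv vv mulr_sumr.
apply: ler_sum => i _; apply: ler_wpM2r => //.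
by rewrite (bigD1 i) //= (le_trans (ler_norm _)) // lerDl sumr_ge0.
Qed.

Lemma rayleigh_le M (x : 'cV[R]_n) :
  (forall a, eigenvalue A a -> a <= M) -> dot x (A *m x) <= M * dot x x.
Proof.
have [l [l_eig l_w]] := symmetric_spectral_weights A_sym.
have [w w_ge0 [-> -> _]] := l_w x => leM; rewrite mulr_sumr.
by apply: ler_sum => i _; apply: ler_wpM2r => //; apply: leM.
Qed.

(** There are finitely many [l i], so the strict bounds on them survive passing to the maximum. *)
Lemma symmetric_contraction :
  (forall a, eigenvalue A a -> `|a| < 1) ->
  exists2 M, 0 <= M < 1 & forall x, norm2 (A *m x) <= M * norm2 x.
Proof.
move=> lt1; have [l [l_eig l_w]] := symmetric_spectral_weights A_sym.
(* The default value 0 also covers [n = 0]. *)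
pose M := \big[Num.max/0]_i `|l i|.
have M_ge0 : 0 <= M by apply: bigmax_ge_id.
exists M; first by rewrite M_ge0; apply/bigmax_ltP; split=> // i _; apply: lt1.
move=> x; apply: norm2_le => //; have [w w_ge0 [-> _ ->]] := l_w x.
rewrite mulr_sumr; apply: ler_sum => i _; apply: ler_wpM2r => //.
rewrite -real_normK ?num_real // ler_pXn2r ?nnegrE //.
exact: le_bigmax.
Qed.

End SymmetricSpectrumBounds.

(** * Operator norm inequality for the spectral norm *)

Section SpectralNorm.
Variables (R : realType) (m n : nat) (A : 'M[R]_(m, n)) (M : R).
Hypothesis A_le : forall x : 'cV[R]_n, norm2 (A *m x) <= M * norm2 x.
Hypothesis M_ge0 : 0 <= M.

Let S := [set norm2 (A *m x) | x in [set x : 'cV[R]_n | norm2 x <= 1]]%classic.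

Let S_ub : ubound S M.
Proof.
move=> _ [x /= x1 <-]; apply: le_trans (A_le x) _.
by rewrite ler_piMr.
Qed.

Let S0 : S 0.
Proof. by exists 0; rewrite /= ?mulmx0 norm20 // ler01. Qed.

Lemma spectral_norm_ge0 : 0 <= spectral_norm A.
Proof. by apply: ub_le_sup S0; exists M. Qed.

Lemma spectral_norm_le : spectral_norm A <= M.
Proof. by apply: ge_sup S_ub; exists 0. Qed.

(** A nonzero [x] is rescaled into the unit ball; the a priori bound [M] ensures that the supremum
    dominates the values there. *)
Lemma norm2_mulmx_le (x : 'cV[R]_n) :
  norm2 (A *m x) <= spectral_norm A * norm2 x.
Proof.
have [/norm2_eq0 -> | x0] := eqVneq (norm2 x) 0.
  by rewrite mulmx0 !norm20 mulr0.
have x_gt0 : 0 < norm2 x by rewrite lt_def x0 norm2_ge0.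
rewrite -ler_pdivrMr // mulrC -norm2Z ?invr_ge0 ?norm2_ge0 //.
rewrite -[leLHS]/(norm2 _) scalemxAr.
apply: ub_le_sup; first by exists M.
exists ((norm2 x)^-1 *: x) => //=.
by rewrite norm2Z ?invr_ge0 ?norm2_ge0 // mulVf.
Qed.

End SpectralNorm.

(** * The Dirichlet form of the graph *)

Section LaplacianForm.
Variables (R : realType) (N : nat) (e : rel 'I_N).
Hypothesis e_sym : symmetric e.
Local Notation L := (laplacian R e).

Lemma laplacian_sym : L^T = L.
Proof.
rewrite linearB /= tr_diag_mx; congr (_ - _).
by apply/matrixP => i j; rewrite !mxE e_sym.
Qed.

Lemma laplacian_mulE m (v : 'M[R]_(N, m)) i k :
  (L *m v) i k = \sum_j (e i j)%:R * (v i k - v j k).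
Proof.
rewrite mulmxBl mul_diag_mx !mxE /degree -sum1dep_card natr_sum mulr_suml.
rewrite big_mkcond /= -sumrB; apply: eq_bigr => j _.
by rewrite !mxE; case: (e i j); rewrite /=; ring.
Qed.

(** The double sum runs over ordered pairs and meets each edge twice. It arises by adding the form
    to its copy with [i] and [j] exchanged. *)
Lemma laplacian_dot (v : 'cV[R]_N) :
  dot v (L *m v) *+ 2 = \sum_i \sum_j (e i j)%:R * (v i 0 - v j 0) ^+ 2.
Proof.
have E : dot v (L *m v) = \sum_i \sum_j (e i j)%:R * (v i 0 * (v i 0 - v j 0)).
  apply: eq_bigr => i _; rewrite laplacian_mulE mulr_sumr.
  by apply: eq_bigr => j _; rewrite mulrCA.
rewrite mulr2n {1}E exchange_big /= E -big_split; apply: eq_bigr => i _.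
rewrite -big_split; apply: eq_bigr => j _; rewrite /= e_sym; ring.
Qed.

Lemma laplacian_dot_ge0 (v : 'cV[R]_N) : 0 <= dot v (L *m v).
Proof.
rewrite -(pmulrn_lge0 _ (isT : (0 < 2)%N)) laplacian_dot.
by do 2!apply: sumr_ge0 => ? _; rewrite mulr_ge0 ?sqr_ge0.
Qed.

(** Each term of the Dirichlet sum vanishes, so [v] agrees across every edge, and then along
    paths. *)
Lemma laplacian_dot_eq0 (v : 'cV[R]_N) :
  connected_graph e -> dot v (L *m v) = 0 -> forall i j, v i 0 = v j 0.
Proof.
move=> e_conn vLv0.
have ge0 i j : 0 <= (e i j)%:R * (v i 0 - v j 0) ^+ 2.
  by rewrite mulr_ge0 ?sqr_ge0.
have /eqP := laplacian_dot v; rewrite vLv0 mul0rn eq_sym psumr_eq0; last first.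
  by move=> i _; apply: sumr_ge0.
move=> /allP v0.
have adj i j : e i j -> v i 0 = v j 0.
  move=> eij; have := v0 i (mem_index_enum _).
  rewrite psumr_eq0 // => /allP/(_ j (mem_index_enum _)).
  by rewrite eij mul1r sqrf_eq0 subr_eq0 => /eqP.
move=> i j; have /connectP[p] := e_conn i j.
elim: p i => [i _ -> // | k p IHp i /= /andP[/adj -> /IHp]]; exact.
Qed.

Lemma laplacian_mul1 : L *m const_mx 1 = 0 :> 'cV[R]_N.
Proof.
apply/matrixP => i k; rewrite laplacian_mulE big1 ?mxE // => j _.
by rewrite !mxE subrr mulr0.
Qed.

Lemma laplacian_dot_le (v : 'cV[R]_N) :
  dot v (L *m v) <= largest_eigenvalue L * dot v v.
Proof.
apply: (rayleigh_le laplacian_sym) => a La.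
exact: ub_le_sup (has_ubound_eigenvalue laplacian_sym) a La.
Qed.

End LaplacianForm.

(** * The selector projector as a 0-1 diagonal matrix *)

Section Selector.
Variables (R : realType) (N : nat) (dim : 'I_N -> nat).
Local Notation d := (\sum_(i < N) dim i)%N.

(** [tagnat.sig1 c] is the block containing coordinate [c], and [tagnat.sig2 c] its position there,
    the only index contributing to the product. *)
Lemma block_projectorE i :
  block_projector R dim i = diag_mx (\row_c (tagnat.sig1 c == i)%:R).
Proof.
apply/matrixP => c c'; rewrite !mxE.
rewrite (eq_bigr (fun k => (c == tagnat.Rank i k)%:R * (c' == tagnat.Rank i k)%:R));
  last by move=> k _; rewrite !mxE.
have [ci|ci] := eqVneq (tagnat.sig1 c) i; last first.
  rewrite mul0rn big1 // => k _.
  case: eqVneq => [cE|]; last by rewrite mul0r.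
  by rewrite cE tagnat.Rank1K eqxx in ci.
case: i / ci.
rewrite (bigD1 (tagnat.sig2 c)) //= tagnat.sig2K eqxx mul1r [X in _ + X]big1 ?addr0.
  by rewrite [c' == c]eq_sym.
move=> k kc; case: eqVneq => [cE|]; last by rewrite mul0r.
have /eqP := congr1 val cE; rewrite -{1}(tagnat.sig2K c) tagnat.eq_Rank eqxx /=.
by rewrite val_eqE eq_sym (negPf kc).
Qed.

(** An index encodes a pair (node, coordinate); it is selected when the node owns the block of the
    coordinate. *)
Definition selected (k : 'I_(N * d)) : bool :=
  tagnat.sig1 (mxtens_unindex k).2 == (mxtens_unindex k).1.

Lemma selectedE i c : selected (mxtens_index (i, c)) = (tagnat.sig1 c == i).
Proof. by rewrite /selected mxtens_indexK. Qed.

Lemma selector_projectorE :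
  selector_projector R dim =
    diag_mx (\row_k (selected k)%:R).
Proof.
apply/matrixP => k l.
case: (mxtens_indexP k) => i c; case: (mxtens_indexP l) => j c'.
have rankE (a : 'I_N) (b : 'I_d) :
    cast_ord (esym (sum_dim_const N d)) (mxtens_index (a, b)) =
    tagnat.Rank a b.
  apply: ord_inj; rewrite tagnat.RankEsum /=. rewrite sum_nat_cond_const.
  by rewrite -sum1dep_card -(big_ord_widen N (fun=> 1%N)) ?sum1_card ?card_ord // ltnW.
rewrite castmxE /= !rankE.
(* The block family is the one that [\mxdiag] unfolds to, with zero blocks off the diagonal. *)
have /matrixP/(_ c c') := @mxblockK R N N (fun=> d) (fun=> d) (fun a b =>
  if a == b then conform_mx 0 (block_projector R dim a) else 0) i j.
rewrite mxE => ->; rewrite [RHS]mxE [in RHS]mxE selectedE.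
rewrite (can_eq (@mxtens_indexK _ _)) xpair_eqE.
case: eqVneq => [_|]; last by rewrite mxE.
by rewrite conform_mx_id block_projectorE !mxE.
Qed.

End Selector.

(** * Stacked vectors, one coordinate at a time *)

Section Tensor.
Variables (R : realType) (N d : nat).
Implicit Types x y : 'cV[R]_(N * d).

(** The values of coordinate [c] at all nodes: a Kronecker product with the identity acts on each
    slice separately. *)
Definition slice x (c : 'I_d) : 'cV[R]_N := \col_i x (mxtens_index (i, c)) 0.

Lemma sum_mxtens (F : 'I_(N * d) -> R) :
  \sum_k F k = \sum_c \sum_i F (mxtens_index (i, c)).
Proof.
rewrite exchange_big pair_big /= (reindex (@mxtens_index N d)) /=.
  by apply: eq_bigr => -[].
by exists (@mxtens_unindex N d) => k _; rewrite ?mxtens_indexK ?mxtens_unindexK.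
Qed.

Lemma dot_slice x y : dot x y = \sum_c dot (slice x c) (slice y c).
Proof.
rewrite /dot sum_mxtens; apply: eq_bigr => c _.
by apply: eq_bigr => i _; rewrite !mxE.
Qed.

Lemma slice_tens1 (M : 'M[R]_N) x c :
  slice ((M *t 1%:M) *m x) c = M *m slice x c.
Proof.
apply/matrixP => i j; rewrite ord1 !mxE sum_mxtens (bigD1 c) //=.
rewrite [X in _ + X]big1 => [|c' cc'].
  by rewrite addr0; apply: eq_bigr => k _; rewrite tensmxE !mxE eqxx mulr1.
by apply: big1 => k _; rewrite tensmxE !mxE eq_sym (negPf cc') mulr0 mul0r.
Qed.

Lemma slice_stack (u : 'cV[R]_d) c : slice (stack N u) c = const_mx (u c 0).
Proof.
apply/matrixP => i j; rewrite !mxE mxtens_indexK /= mul1r.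
by congr (u _ _); apply: ord1.
Qed.

Lemma norm2_stack (u : 'cV[R]_d) : norm2 (stack N u) = Num.sqrt N%:R * norm2 u.
Proof.
rewrite !norm2E -sqrtrM // dot_slice mulr_sumr; congr Num.sqrt.
apply: eq_bigr => c _; rewrite slice_stack /dot.
under eq_bigr do rewrite !mxE.
by rewrite sumr_const card_ord mulr_natl.
Qed.

(** Mixed-product rule: the left factor acts on the all-ones vector only. *)
Lemma tens_stack (M : 'M[R]_N) (u : 'cV[R]_d) :
  M *m const_mx 1 = const_mx 1 :> 'cV[R]_N ->
  (M *t 1%:M) *m stack N u = stack N u.
Proof.
move=> M1; have := tensmx_mul M 1%:M (const_mx 1 : 'cV[R]_N) u.
by rewrite M1 mul1mx.
Qed.

Lemma stackB (u v : 'cV[R]_d) : stack N (u - v) = stack N u - stack N v.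
Proof. by apply/matrixP => k l; rewrite !mxE mulrBr. Qed.

End Tensor.

(** * Spectrum of the system matrix and the error recursion *)

Section SystemMatrix.
Variables (R : realType) (N : nat) (e : rel 'I_N) (dim : 'I_N -> nat) (alpha : R).
Hypotheses (e_sym : symmetric e) (e_conn : connected_graph e).
Hypotheses (alpha_gt0 : 0 < alpha)
  (alpha_lt : alpha < 1 / largest_eigenvalue (laplacian R e)).
Local Notation L := (laplacian R e).
Local Notation d := (\sum_(i < N) dim i)%N.
Local Notation P := (selector_projector R dim).
Local Notation W := (1%:M - alpha *: L).
Implicit Types x : 'cV[R]_(N * d).

Lemma sys_mx_sym : (sys_mx dim W)^T = sys_mx dim W.
Proof.
rewrite linearB /= trmx_tens trmx1 linearB linearZ /= trmx1 laplacian_sym //.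
by rewrite /sys_mx selector_projectorE tr_diag_mx.
Qed.

Lemma selector_dot x :
  dot x (P *m x) = \sum_k (selected k)%:R * x k 0 ^+ 2.
Proof.
by apply: eq_bigr => k _; rewrite selector_projectorE mul_diag_mx !mxE mulrCA.
Qed.

Lemma selector_dot_ge0 x : 0 <= dot x (P *m x).
Proof.
by rewrite selector_dot; apply: sumr_ge0 => k _; rewrite mulr_ge0 ?sqr_ge0.
Qed.

Lemma selector_dot_le x : dot x (P *m x) <= dot x x.
Proof.
rewrite selector_dot; apply: ler_sum => k _; rewrite -expr2.
by case: (selected k); rewrite ?mul1r // mul0r sqr_ge0.
Qed.

Lemma selector_dot_eq0 x k : dot x (P *m x) = 0 -> selected k -> x k 0 = 0.
Proof.
rewrite selector_dot => /eqP; rewrite psumr_eq0 => [/allP/(_ k)|i _]; last first.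
  by rewrite mulr_ge0 ?sqr_ge0.
by rewrite mem_index_enum => /(_ isT) /[swap] ->; rewrite mul1r sqrf_eq0 => /eqP.
Qed.

Lemma sys_mx_dot x :
  dot x (sys_mx dim W *m x) =
  dot x x - alpha * \sum_c dot (slice x c) (L *m slice x c) - dot x (P *m x).
Proof.
rewrite mulmxBl dotBr; congr (_ - _).
rewrite !dot_slice mulr_sumr -sumrB; apply: eq_bigr => c _.
by rewrite slice_tens1 mulmxBl mul1mx -scalemxAl dotBr dotZr.
Qed.

(** The largest eigenvalue is positive because its inverse exceeds [alpha], so the division can be
    cleared. *)
Lemma alpha_largest_eigenvalue : alpha * largest_eigenvalue L < 1.
Proof.
have : 0 < 1 / largest_eigenvalue L by apply: lt_trans alpha_lt.
by rewrite div1r invr_gt0 => lam0; rewrite -ltr_pdivlMr.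
Qed.

Lemma sys_mx_eigenvalue_lt1 a : eigenvalue (sys_mx dim W) a -> `|a| < 1.
Proof.
move=> /(symmetric_eigenvector sys_mx_sym)[x Ax x0].
have xx := dot_gt0 x0.
have := sys_mx_dot x; rewrite Ax dotZr.
set Q := \sum_c dot _ _ => aE.
have Q_ge0 : 0 <= Q by apply: sumr_ge0 => c _; apply: laplacian_dot_ge0.
have Q_le : alpha * Q < dot x x.
  apply: le_lt_trans (_ : alpha * (largest_eigenvalue L * dot x x) < _).
    rewrite ler_pM2l // [dot x x]dot_slice mulr_sumr.
    by apply: ler_sum => c _; apply: laplacian_dot_le.
  by rewrite mulrA gtr_pMl // alpha_largest_eigenvalue.
have p_ge0 := selector_dot_ge0 x; have p_le := selector_dot_le x.
rewrite ltr_norml -(ltr_pM2r xx) -[a < 1](ltr_pM2r xx) mulN1r mul1r.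
apply/andP; split; first by rewrite aE; lra.
have aQ_ge0 : 0 <= alpha * Q by rewrite mulr_ge0 // ltW.
rewrite ltNge; apply/negP => ge1; case/eqP: x0.
have p0 : dot x (P *m x) = 0 by lra.
have {aQ_ge0} Q0 : Q = 0.
  by have /eqP : alpha * Q = 0 by [lra]; rewrite mulf_eq0 gt_eqF // => /eqP.
apply/matrixP => k j; rewrite ord1 mxE; case: (mxtens_indexP k) => i c.
(* Slice [c] is constant, so its value can be moved to the node [tagnat.sig1 c] that anchors
   coordinate [c], where the selector form forces zero. *)
have xc : slice x c i 0 = slice x c (tagnat.sig1 c) 0.
  apply: laplacian_dot_eq0 e_sym _ e_conn _ _ _.
  move/eqP: Q0; rewrite psumr_eq0 => [/allP/(_ c)|c' _]; last first.
    exact: laplacian_dot_ge0.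
  by rewrite mem_index_enum => /(_ isT)/eqP.
rewrite !mxE in xc; rewrite xc.
by apply: selector_dot_eq0 => //; rewrite selectedE.
Qed.

Lemma diffusion_fixes_ones : W *m const_mx 1 = const_mx 1 :> 'cV[R]_N.
Proof. by rewrite mulmxBl mul1mx -scalemxAl laplacian_mul1 scaler0 subr0. Qed.

(** Since the stacked [u k] is fixed by the diffusion, subtracting it from the update leaves only
    terms in the error. *)
Lemma tracking_error_step T u s k t :
  warm_started_diffusion W T u s -> (t < T)%N ->
  tracking_error u s k t.+1 = sys_mx dim W *m tracking_error u s k t.
Proof.
move=> [step _] tT; rewrite /tracking_error step // mulmxBl !mulmxBr.
by rewrite tens_stack ?diffusion_fixes_ones // opprB addrAC.
Qed.

End SystemMatrix.

Theorem theorem1 (R : realType) (N : nat) (hN : (2 <= N)%N)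
    (e : rel 'I_N) (e_sym : symmetric e) (e_irr : irreflexive e)
    (e_conn : connected_graph e)
    (dim : 'I_N -> nat)
    (alpha : R) (alpha_gt0 : 0 < alpha)
    (alpha_lt : alpha < 1 / largest_eigenvalue (laplacian R e)) :
  let W : 'M[R]_N := 1%:M - alpha *: laplacian R e in
  let sigma : R := spectral_norm (sys_mx dim W) in
  0 <= sigma < 1
  /\ forall (u : nat -> 'cV[R]_(\sum_(i < N) dim i)) (T : nat)
            (s : nat -> nat -> 'cV[R]_(N * \sum_(i < N) dim i)),
     (1 <= T)%N -> warm_started_diffusion W T u s ->
     forall k : nat,
       norm2 (tracking_error u s k T)
         <= sigma ^+ T * norm2 (tracking_error u s k 0)
       /\ norm2 (tracking_error u s k.+1 0)
         <= sigma ^+ T * norm2 (tracking_error u s k 0)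
            + Num.sqrt N%:R * norm2 (u k.+1 - u k).
Proof.
move=> W sigma.
have [M /andP[M_ge0 M_lt1] A_le] := symmetric_contraction
  (sys_mx_sym dim alpha e_sym)
  (sys_mx_eigenvalue_lt1 e_sym e_conn alpha_gt0 alpha_lt).
have sigma_ge0 : 0 <= sigma by apply: spectral_norm_ge0 A_le M_ge0.
split.
  by rewrite sigma_ge0 (le_lt_trans _ M_lt1) //; apply: spectral_norm_le.
move=> u T s _ run k.
(* The induction stops at [T], as the recursion constrains only rounds below [T]. *)
have contract t : (t <= T)%N ->
    norm2 (tracking_error u s k t) <= sigma ^+ t * norm2 (tracking_error u s k 0).
  elim: t => [|t IHt] tT; first by rewrite expr0 mul1r.
  rewrite (tracking_error_step _ run) //.
  apply: le_trans (norm2_mulmx_le A_le M_ge0 _) _.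
  by rewrite exprS -mulrA ler_wpM2l // IHt // ltnW.
split; first exact: contract.
(* The warm start keeps the estimate and moves only the target, by the stacked increment of [u]. *)
have -> : tracking_error u s k.+1 0 =
    tracking_error u s k T - stack N (u k.+1 - u k).
  by rewrite /tracking_error run.2 stackB opprB addrA subrK.
apply: le_trans (norm2D _ _) _; rewrite norm2N norm2_stack.
by apply: lerD; first exact: contract.
Qed.
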